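(* There exist a (connected, infinite) median graph $G^*$ and a vertex $\alpha$ of $G^*$ such that the pointed median graph $G^*_\alpha$ has maximum out-degree $5$ and the pointed contact graph $\Gamma_\alpha(G^* )$ has infinite chromatic number. In particular, any nice labeling of the event structure $\mathcal E_\alpha$ (of degree $5$) whose domain is $G^*_\alpha$ requires an infinite number of labels.
   Context: Graphs are simple and connected, possibly infinite, with the shortest-path distance $d$. The interval is $I(u,v)=\{x: d(u,x)+d(x,v)=d(u,v)\}$. A graph is median if $I(x,y)\cap I(y,z)\cap I(z,x)$ is a single vertex for every triple of vertices $x,y,z$. For a vertex $v$ of a median graph $G$, the pointed median graph $G_v$ is $G$ with each edge $xy$ directed from $x$ to $y$ iff $d(x,v)<d(y,v)$; the origin of a directed edge is its tail, and out-degrees refer to this orientation. The Djoković–Winkler relation $\Theta$ on edges: $xy\,\Theta\, zw$ iff $d(x,z)+d(y,w)\neq d(x,w)+d(y,z)$; in a median graph it is an equivalence relation, and each class $\Theta_i$ splits the vertex set into two complementary halfspaces $A_i\ni v$ and $B_i$. Two classes $\Theta_i,\Theta_j$ cross if some 4-cycle has two opposite edges in $\Theta_i$ and the other two in $\Theta_j$; otherwise they are compatible. $\Theta_i$ separates $v$ from $\Theta_j$ if they are compatible and all edges of $\Theta_j$ lie in $B_i$. The pointed contact graph $\Gamma_v(G)$ has the $\Theta$-classes as vertices, two distinct classes $\Theta_i,\Theta_j$ being adjacent iff they cross or there are edges $e\in\Theta_i$, $e'\in\Theta_j$ which, directed as in $G_v$, have the same origin and do not lie in a common 4-cycle. An event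 structure is $\mathcal E=(E,\le,\smile)$ with $\le$ a partial order on $E$ such that $\{e'\,:\,e'\le e\}$ is finite for every $e$, $\smile$ an irreflexive symmetric binary relation (conflict), and $e\smile e'$, $e'\le e''$ imply $e\smile e''$. Its configurations are the conflict-free, downward-closed subsets of $E$; its domain is the set of configurations ordered by inclusion. Two events are concurrent if they are $\le$-incomparable and not in conflict; a conflict $e'\smile e''$ is minimal if there is no $e\ne e',e''$ with ($e\le e'$ and $e\smile e''$) or ($e\le e''$ and $e\smile e'$). Events are independent if concurrent or in minimal conflict; the degree of $\mathcal E$ is the supremum of sizes of sets of pairwise independent events. A nice labeling is a map $\lambda:E\to\Lambda$ giving distinct labels to any two independent events. For a pointed median graph $G_v$, the event structure $\mathcal E_v$ has as events the $\Theta$-classes of $G$, with $\Theta_i\le\Theta_j$ iff $\Theta_i=\Theta_j$ or $\Theta_i$ separates $v$ from $\Theta_j$, and $\Theta_i\smile\Theta_j$ iff they are compatible and neither separates $v$ from the other; the Hasse diagram of its domain is isomorphic to $G_v$ (this is what ''whose domain is $G_v$'' means). *)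

(* Defs.v *)
From Stdlib Require Import Classical ClassicalEpsilon List Arith.


Section Graphs.
Context {V : Type} (adj : V -> V -> Prop).

Definition simple_graph : Prop :=
  (forall x y, adj x y -> adj y x) /\ (forall x, ~ adj x x).

Inductive walk : V -> V -> nat -> Prop :=
| walk0 x : walk x x 0
| walkS x y z n : adj x y -> walk y z n -> walk x z (S n).

Definition connected : Prop := forall u v, exists n, walk u v n.

(* shortest-path distance (correct for connected graphs) *)
Definition dist (u v : V) : nat :=
  epsilon (inhabits 0) (fun n => walk u v n /\ forall m, walk u v m -> n <= m).

Definition in_interval (u v x : V) : Prop := dist u x + dist x v = dist u v.

Definition median : Prop :=
  forall x y z, exists! m, in_interval x y m /\ in_interval y z m /\ in_interval z x m.

(* edges, represented by an orientation (x,y) with adj x y *)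
Definition edge : Type := { p : V * V | adj (fst p) (snd p) }.
Definition e1 (e : edge) : V := fst (proj1_sig e).
Definition e2 (e : edge) : V := snd (proj1_sig e).

(* Djokovic-Winkler relation (independent of the chosen orientations) *)
Definition theta (e f : edge) : Prop :=
  dist (e1 e) (e1 f) + dist (e2 e) (e2 f) <> dist (e1 e) (e2 f) + dist (e2 e) (e1 f).

Definition theta_class : Type :=
  { C : edge -> Prop | exists e, forall f, C f <-> theta e f }.
Definition in_class (C : theta_class) (e : edge) : Prop := proj1_sig C e.

Definition edge_is (e : edge) (a b : V) : Prop :=
  (e1 e = a /\ e2 e = b) \/ (e1 e = b /\ e2 e = a).

Definition C4 (a b c d : V) : Prop :=
  adj a b /\ adj b c /\ adj c d /\ adj d a /\
  a <> b /\ a <> c /\ a <> d /\ b <> c /\ b <> d /\ c <> d.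

Definition on_C4 (e : edge) (a b c d : V) : Prop :=
  edge_is e a b \/ edge_is e b c \/ edge_is e c d \/ edge_is e d a.

Definition common_C4 (e f : edge) : Prop :=
  exists a b c d, C4 a b c d /\ on_C4 e a b c d /\ on_C4 f a b c d.

Definition cross (Ci Cj : theta_class) : Prop :=
  exists a b c d, C4 a b c d /\
  exists f1 f2 f3 f4 : edge,
    edge_is f1 a b /\ edge_is f2 b c /\ edge_is f3 c d /\ edge_is f4 d a /\
    in_class Ci f1 /\ in_class Ci f3 /\ in_class Cj f2 /\ in_class Cj f4.

Definition compatible (Ci Cj : theta_class) : Prop := ~ cross Ci Cj.

Definition origin (v : V) (e : edge) : V :=
  if Nat.ltb (dist (e1 e) v) (dist (e2 e) v) then e1 e else e2 e.

Definition out_nb (v x y : V) : Prop := adj x y /\ dist x v < dist y v.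

Definition max_outdeg_eq (v : V) (k : nat) : Prop :=
  (forall x (l : list V), NoDup l -> (forall y, In y l -> out_nb v x y) ->
      length l <= k) /\
  (exists x (l : list V), NoDup l /\ (forall y, In y l -> out_nb v x y) /\
      length l = k).

Definition contact_adj (v : V) (Ci Cj : theta_class) : Prop :=
  Ci <> Cj /\
  (cross Ci Cj \/
   exists e f, in_class Ci e /\ in_class Cj f /\ origin v e = origin v f /\
               ~ common_C4 e f).

(* halfspace B_C (the one not containing v): for an edge xy of C with
   d(x,v) < d(y,v), B_C = W(y,x) = {w | d(w,y) < d(w,x)} *)
Definition in_B (v : V) (C : theta_class) (w : V) : Prop :=
  exists e, in_class C e /\ dist (e1 e) v < dist (e2 e) v /\
            dist w (e2 e) < dist w (e1 e).

Definition separates (v : V) (Ci Cj : theta_class) : Prop :=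
  compatible Ci Cj /\
  forall e, in_class Cj e -> in_B v Ci (e1 e) /\ in_B v Ci (e2 e).

Definition ev_le (v : V) (Ci Cj : theta_class) : Prop :=
  Ci = Cj \/ separates v Ci Cj.

Definition ev_conf (v : V) (Ci Cj : theta_class) : Prop :=
  Ci <> Cj /\ compatible Ci Cj /\ ~ separates v Ci Cj /\ ~ separates v Cj Ci.

End Graphs.

Definition infinite_type (T : Type) : Prop := ~ exists l : list T, forall x, In x l.

Definition infinite_chromatic {T : Type} (R : T -> T -> Prop) : Prop :=
  forall n : nat, ~ exists f : T -> nat,
    (forall t, f t < n) /\ (forall s t, R s t -> f s <> f t).

Section EventStructures.
Context {E : Type} (le conf : E -> E -> Prop).

Definition concurrent (e f : E) : Prop := ~ le e f /\ ~ le f e /\ ~ conf e f.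

Definition minimal_conflict (e' e'' : E) : Prop :=
  conf e' e'' /\
  ~ exists e, e <> e' /\ e <> e'' /\
      ((le e e' /\ conf e e'') \/ (le e e'' /\ conf e e')).

Definition independent (e f : E) : Prop := concurrent e f \/ minimal_conflict e f.

Definition pairwise_independent (l : list E) : Prop :=
  NoDup l /\ forall e f, In e l -> In f l -> e <> f -> independent e f.

Definition degree_eq (k : nat) : Prop :=
  (forall l, pairwise_independent l -> length l <= k) /\
  (exists l, pairwise_independent l /\ length l = k).

Definition nice_labeling {L : Type} (lab : E -> L) : Prop :=
  forall e f, independent e f -> lab e <> lab f.

End EventStructures.

(* Main.v *)
(* Burling's triangle-free graphs of unbounded chromatic number are realised inside the
   product of a binary tree and a ray. Each set is a subtree times an interval, and any
   point lies in at most two sets. Erecting a prism over each set gives a median graph of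
   out-degree at most 2 + 1 + 2, in which overlapping sets yield two events that are
   enabled at a common vertex and in conflict, so a colouring must separate them.

   The tree is the tree of all plays of an on-line colouring game: a move creates a new
   interval and then discards the older ones it meets. Against every finite colouring
   some branch of the tree forces arbitrarily many colours.

   Median graphs are handled as families of subsets of a set of events, closed under
   majority and connected under flipping one event; the Theta-classes are the events. *)

Require Import Defs.
From Stdlib Require Import Classical ClassicalEpsilon List Arith.
From Stdlib Require Import FunctionalExtensionality PropExtensionality Bool Lia FinFun Cantor.

(** * Families of sets and their symmetric differences *)

Section MedianSystem.

Context {V E : Type} (mem : V -> E -> bool).

Definition flips (x y : V) (e : E) : Prop :=
  mem y e = negb (mem x e) /\ forall g, g <> e -> mem y g = mem x g.

Definition flip_adj (x y : V) : Prop := exists e, flips x y e.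

(** A relation, because finiteness of the symmetric difference only follows from connectedness. *)
Definition diff_card (x y : V) (n : nat) : Prop :=
  exists l, NoDup l /\ length l = n /\ forall e, In e l <-> mem x e <> mem y e.

Definition majb (a b c : bool) : bool := if a then b || c else b && c.

(** Together with [conf_ev], this reads causality and conflict off membership alone; both are
    matched later with the halfspace definitions. *)
Definition le_ev (e f : E) : Prop := forall x, mem x f = true -> mem x e = true.

Definition conf_ev (e f : E) : Prop :=
  e <> f /\ forall x, mem x e = true -> mem x f = true -> False.

Lemma flips_sym x y e : flips x y e -> flips y x e.
Proof.
  intros [H1 H2]; split.
  - rewrite H1; now destruct (mem x e).
  - intros g Hg; now rewrite H2.
Qed.

Lemma flips_neq x y e : flips x y e -> mem x e <> mem y e.
Proof. intros [H _]; rewrite H; now destruct (mem x e). Qed.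

Lemma flips_eq x y e g : flips x y e -> g <> e -> mem y g = mem x g.
Proof. intros [_ H]; auto. Qed.

Lemma flips_fun x y e f : flips x y e -> flips x y f -> e = f.
Proof.
  intros H1 H2; apply NNPP; intros N.
  apply (flips_neq _ _ _ H1). symmetry. exact (flips_eq _ _ _ _ H2 N).
Qed.

Lemma bool_neq (a b : bool) : a <> b -> a = negb b.
Proof. destruct a, b; simpl; congruence. Qed.

Lemma flips_iff x y e f : flips x y f -> (mem x e <> mem y e <-> e = f).
Proof.
  intros H; split.
  - intros N; apply NNPP; intros D; apply N; symmetry; exact (flips_eq _ _ _ _ H D).
  - intros ->; exact (flips_neq _ _ _ H).
Qed.

Lemma diff_card_fun x y m n : diff_card x y m -> diff_card x y n -> m = n.
Proof.
  intros (l & Nl & <- & Hl) (k & Nk & <- & Hk).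
  apply Nat.le_antisymm; apply NoDup_incl_length; auto; intros e He.
  - apply Hk, Hl, He.
  - apply Hl, Hk, He.
Qed.

Lemma diff_card_sym x y n : diff_card x y n -> diff_card y x n.
Proof.
  intros (l & Nl & Hn & Hl); exists l; repeat split; auto.
  - intros H D; apply Hl in H; auto.
  - intros H; apply Hl; auto.
Qed.

Lemma diff_card_refl x : diff_card x x 0.
Proof. exists nil; repeat split; [constructor | intros [] | intros H; now elim H]. Qed.

Lemma diff_card_flip x y z e n :
  flips x y e -> mem x e = mem z e -> diff_card x z n -> diff_card y z (S n).
Proof.
  intros F Hz (l & Nl & <- & Hl); exists (e :: l); repeat split.
  - constructor; auto. intros Hi; now apply Hl in Hi.
  - intros [<- | Hi].
    + intros D. apply (flips_neq _ _ _ F). congruence.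
    + assert (e0 <> e) by (intros ->; now apply Hl in Hi).
      rewrite (flips_eq _ _ _ _ F H). now apply Hl.
  - intros D. destruct (classic (e = e0)) as [| Ne]; [now left | right].
    apply Hl. rewrite (flips_eq _ _ _ e0 F) in D; auto.
Qed.

Lemma diff_card_unflip x y z e n :
  flips x y e -> mem x e <> mem z e -> diff_card x z n ->
  exists m, n = S m /\ diff_card y z m.
Proof.
  intros F Hz (l & Nl & <- & Hl).
  destruct (in_split e l) as (l1 & l2 & ->); [now apply Hl|].
  exists (length l1 + length l2); split; [rewrite length_app; simpl; lia|].
  exists (l1 ++ l2); repeat split.
  - now apply NoDup_remove_1 in Nl.
  - apply length_app.
  - intros Hi.
    assert (e0 <> e) by (intros ->; now apply NoDup_remove_2 in Nl).
    rewrite (flips_eq _ _ _ _ F H). apply Hl.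
    apply in_app_iff in Hi; apply in_app_iff; simpl; tauto.
  - intros D.
    assert (e0 <> e).
    { intros ->. apply D. destruct F as [F _]. rewrite F.
      destruct (mem x e), (mem z e); simpl; congruence. }
    rewrite (flips_eq _ _ _ _ F H) in D. apply Hl in D.
    apply in_app_iff in D; apply in_app_iff; simpl in D. intuition congruence.
Qed.

(** * The flip graph: distances, intervals and medians *)

Context (o : V).
Context (ext : forall x y, (forall e, mem x e = mem y e) -> x = y).
Context (maj : forall x y z, exists m, forall e,
  mem m e = majb (mem x e) (mem y e) (mem z e)).
Context (mem_o : forall e, mem o e = false).
Context (conn : forall x, exists n, walk flip_adj x o n).
Context (edge_ex : forall e, exists x y, flips x y e).

Lemma flip_simple : simple_graph flip_adj.
Proof.
  split.
  - intros x y [e He]; exists e; now apply flips_sym.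
  - intros x [e He]. now apply flips_neq in He.
Qed.

Lemma walk_app x y z m n :
  walk flip_adj x y m -> walk flip_adj y z n -> walk flip_adj x z (m + n).
Proof. induction 1; simpl; auto. intros; econstructor; eauto. Qed.

Lemma walk_rev x y n : walk flip_adj x y n -> walk flip_adj y x n.
Proof.
  induction 1 as [| x y z n A W IH]; [constructor|].
  replace (S n) with (n + 1) by lia. eapply walk_app; eauto.
  econstructor; [apply flip_simple; eauto | constructor].
Qed.

Lemma flip_connected : connected flip_adj.
Proof.
  intros u v. destruct (conn u) as [n Hn], (conn v) as [m Hm].
  exists (n + m). eapply walk_app; eauto using walk_rev.
Qed.

(** One flip changes the size of the symmetric difference by exactly one, which bounds the distance
    from below. *)
Lemma walk_diff_card x y n : walk flip_adj x y n -> exists k, k <= n /\ diff_card x y k.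
Proof.
  induction 1 as [x | x y z n [e F] W (k & Hk & D)].
  - exists 0; split; auto using diff_card_refl.
  - apply flips_sym in F. destruct (classic (mem y e = mem z e)) as [Q | Q].
    + exists (S k); split; [lia | eapply diff_card_flip; eauto].
    + destruct (diff_card_unflip _ _ _ _ _ F Q D) as (m & -> & D').
      exists m; split; auto; lia.
Qed.

Lemma diff_card_ex x y : exists k, diff_card x y k.
Proof.
  destruct (flip_connected x y) as [n W].
  destruct (walk_diff_card _ _ _ W) as (k & _ & D); eauto.
Qed.

(* The medians of [x], [y] and the successive vertices of a walk from [x] to [y] form
   a walk inside the interval; its first move is the required flip. *)
Lemma step_towards x y :
  x <> y -> exists x' e, flips x x' e /\ mem x e <> mem y e.
Proof.
  intros N. destruct (flip_connected x y) as [n W].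
  assert (G : forall v n, walk flip_adj v y n ->
    (forall e, majb (mem x e) (mem v e) (mem y e) = mem x e) ->
    exists x' e, flips x x' e /\ mem x e <> mem y e).
  { clear n W. intros v n W. revert N.
    induction W as [y | v v' y n [e F] W IH]; intros N M.
    - exfalso; apply N, ext. intros e; specialize (M e).
      destruct (mem x e), (mem y e); simpl in M; congruence.
    - destruct (classic (majb (mem x e) (mem v' e) (mem y e) = mem x e)) as [Q | Q].
      + apply IH; auto. intros g. destruct (classic (g = e)) as [-> | Ng]; auto.
        rewrite (flips_eq _ _ _ _ F Ng); apply M.
      + destruct (maj x v' y) as [m Hm]. exists m, e; repeat split.
        * rewrite Hm. now apply bool_neq.
        * intros g Ng. rewrite Hm, (flips_eq _ _ _ _ F Ng); apply M.
        * intros D; apply Q. rewrite <- D. now destruct (mem x e), (mem v' e). }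
  apply (G x n W). intros e; now destruct (mem x e), (mem y e).
Qed.

(** Each flip given by [step_towards] removes one element of the symmetric difference, so the lower
    bound on the distance is attained. *)
Lemma diff_card_walk n x y : diff_card x y n -> walk flip_adj x y n.
Proof.
  revert x; induction n as [| n IH]; intros x D.
  - replace y with x; [constructor|]. destruct D as (l & _ & Hn & Hl).
    destruct l; [| discriminate]. apply ext; intros e.
    apply NNPP; intros Q. now apply Hl in Q.
  - destruct (classic (x = y)) as [-> | N].
    { pose proof (diff_card_fun _ _ _ _ D (diff_card_refl y)); discriminate. }
    destruct (step_towards _ _ N) as (x' & e & F & Q).
    destruct (diff_card_unflip _ _ _ _ _ F Q D) as (m & Hm & D').
    injection Hm as ->. econstructor; [exists e; eauto | auto].
Qed.

Lemma dist_diff_card x y : diff_card x y (dist flip_adj x y).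
Proof.
  destruct (diff_card_ex x y) as [k D].
  assert (X : exists n, walk flip_adj x y n /\ forall m, walk flip_adj x y m -> n <= m).
  { exists k; split; [now apply diff_card_walk|]. intros m W.
    destruct (walk_diff_card _ _ _ W) as (j & Hj & D').
    rewrite (diff_card_fun _ _ _ _ D D'); auto. }
  apply (epsilon_spec (inhabits 0)) in X. fold (dist flip_adj x y) in X.
  destruct X as [X1 X2].
  destruct (walk_diff_card _ _ _ X1) as (j & Hj & D').
  rewrite <- (diff_card_fun _ _ _ _ D D') in Hj.
  replace (dist flip_adj x y) with k; auto.
  apply Nat.le_antisymm; auto. apply X2. now apply diff_card_walk.
Qed.

Lemma dist_sym x y : dist flip_adj x y = dist flip_adj y x.
Proof. eapply diff_card_fun; [| apply diff_card_sym]; apply dist_diff_card. Qed.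

Lemma dist_flip x y z e : flips x y e -> mem x e = mem z e ->
  dist flip_adj y z = S (dist flip_adj x z).
Proof.
  intros F Q. eapply diff_card_fun; [apply dist_diff_card|].
  eapply diff_card_flip; eauto using dist_diff_card.
Qed.

Lemma dist_flip_lt x y z e : flips x y e ->
  (dist flip_adj x z < dist flip_adj y z <-> mem x e = mem z e).
Proof.
  intros F; split; intros H.
  - apply NNPP; intros Q.
    assert (mem y e = mem z e).
    { destruct F as [F _]; rewrite F. destruct (mem x e), (mem z e); simpl; congruence. }
    apply flips_sym in F. rewrite (dist_flip _ _ _ _ F H0) in H; lia.
  - rewrite (dist_flip _ _ _ _ F H); lia.
Qed.

(** Every event separating [x] from [y] separates [m] from one of them. The sizes add up exactly
    when no event is changed on both legs. *)
Lemma interval_iff x y m :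
  in_interval flip_adj x y m <-> forall e, mem x e = mem y e -> mem m e = mem x e.
Proof.
  unfold in_interval.
  destruct (dist_diff_card x m) as (l1 & N1 & <- & H1).
  destruct (dist_diff_card m y) as (l2 & N2 & <- & H2).
  destruct (dist_diff_card x y) as (l & N & <- & H).
  rewrite <- length_app.
  assert (Inc : incl l (l1 ++ l2)).
  { intros e He; apply H in He. apply in_app_iff. rewrite H1, H2.
    destruct (mem x e), (mem y e), (mem m e); intuition congruence. }
  split.
  - intros L e Q. apply NNPP; intros D.
    apply (proj1 (H e)); auto.
    apply (NoDup_length_incl (l := l) (l' := l1 ++ l2)); [exact N | lia | exact Inc |].
    apply in_app_iff; left. apply H1; auto.
  - intros B. apply Nat.le_antisymm; [| now apply NoDup_incl_length].
    apply NoDup_incl_length.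
    + apply NoDup_app; auto. intros e I1 I2. apply H1 in I1. apply H2 in I2.
      specialize (B e). destruct (mem x e), (mem y e), (mem m e); intuition congruence.
    + intros e He. apply H. apply in_app_iff in He. rewrite H1, H2 in He.
      specialize (B e). destruct (mem x e), (mem y e), (mem m e); intuition congruence.
Qed.

(** Of three bits two agree, and the corresponding interval condition fixes that coordinate of the
    median. *)
Lemma flip_median : median flip_adj.
Proof.
  intros x y z. destruct (maj x y z) as [m Hm]. exists m; split.
  - rewrite !interval_iff; repeat split; intros e; rewrite Hm;
      destruct (mem x e), (mem y e), (mem z e); simpl; congruence.
  - intros m'; rewrite !interval_iff; intros (A & B & C). apply ext; intros e.
    rewrite Hm. specialize (A e); specialize (B e); specialize (C e).
    destruct (mem x e), (mem y e), (mem z e); simpl;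
      solve [now rewrite A | now rewrite B | now rewrite C].
Qed.

(** * Theta-classes correspond to events *)

Definition eflips (u : edge flip_adj) (e : E) : Prop := flips (e1 flip_adj u) (e2 flip_adj u) e.

Lemma eflips_ex u : exists e, eflips u e.
Proof. exact (proj2_sig u). Qed.

(** If [x] and [y] differ in [e] alone, their distances to [v] differ by one, with a sign depending
    on the value of [e] at [v]. The two sums thus differ exactly when the ends of the other edge
    disagree on [e]. *)
Lemma theta_iff u w : theta flip_adj u w <-> exists e, eflips u e /\ eflips w e.
Proof.
  unfold theta, eflips.
  destruct (eflips_ex u) as [e Fu], (eflips_ex w) as [f Fw]. unfold eflips in *.
  set (x := e1 flip_adj u) in *. set (y := e2 flip_adj u) in *.
  set (z := e1 flip_adj w) in *. set (t := e2 flip_adj w) in *.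
  assert (C : forall v, (mem x e = mem v e /\ dist flip_adj y v = S (dist flip_adj x v)) \/
                   (mem y e = mem v e /\ dist flip_adj x v = S (dist flip_adj y v))).
  { intros v. destruct (classic (mem x e = mem v e)) as [Q | Q].
    - left; split; auto. eapply dist_flip; eauto.
    - right. assert (mem y e = mem v e).
      { destruct Fu as [Fu _]; rewrite Fu. destruct (mem x e), (mem v e); simpl; congruence. }
      split; auto. eapply dist_flip; eauto using flips_sym. }
  split.
  - intros H. exists e; split; auto.
    assert (mem z e <> mem t e).
    { intros Q. apply H.
      destruct (C z) as [[A1 A2] | [A1 A2]], (C t) as [[B1 B2] | [B1 B2]]; try lia;
      exfalso; apply (flips_neq _ _ _ Fu); congruence. }
    apply (flips_iff _ _ _ _ Fw) in H0. now subst f.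
  - intros (g & Gu & Gw) H.
    rewrite <- (flips_fun _ _ _ _ Fu Gu) in Gw. apply (flips_neq _ _ _ Gw).
    destruct (C z) as [[A1 A2] | [A1 A2]], (C t) as [[B1 B2] | [B1 B2]];
      try lia; congruence.
Qed.

Definition mk_edge (x y : V) (H : flip_adj x y) : edge flip_adj :=
  exist (fun p => flip_adj (fst p) (snd p)) (x, y) H.

Lemma edge_of_flip x y e : flips x y e ->
  exists u, e1 flip_adj u = x /\ e2 flip_adj u = y /\ eflips u e.
Proof. intros F. now exists (mk_edge x y (ex_intro _ e F)). Qed.

Lemma event_class e : exists u, forall w, eflips w e <-> theta flip_adj u w.
Proof.
  destruct (edge_ex e) as (x & y & F).
  destruct (edge_of_flip _ _ _ F) as (u & _ & _ & Fu). exists u; intros w.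
  rewrite theta_iff; split; [eauto|].
  intros (g & Gu & Gw). now rewrite (flips_fun _ _ _ _ Fu Gu).
Qed.

Definition cls (e : E) : theta_class flip_adj :=
  exist _ (fun w => eflips w e) (event_class e).

Lemma cls_inj e f : cls e = cls f -> e = f.
Proof.
  intros H. destruct (edge_ex e) as (x & y & F).
  destruct (edge_of_flip _ _ _ F) as (u & _ & _ & Fu).
  apply (f_equal (fun C => in_class flip_adj C u)) in H.
  eapply flips_fun; [exact Fu|]. change (in_class flip_adj (cls f) u). now rewrite <- H.
Qed.

Lemma cls_surj C : exists e, C = cls e.
Proof.
  destruct C as [P [u Hu]]. destruct (eflips_ex u) as [e Fu]. exists e.
  assert (P = fun w => eflips w e).
  { apply functional_extensionality; intros w. apply propositional_extensionality.
    rewrite Hu, theta_iff; split; [| eauto].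
    intros (g & Gu & Gw). now rewrite (flips_fun _ _ _ _ Fu Gu). }
  subst P. unfold cls. f_equal. apply proof_irrelevance.
Qed.

(** * Squares and crossing classes *)

Lemma edge_is_flips u x y e : edge_is flip_adj u x y -> (eflips u e <-> flips x y e).
Proof.
  unfold edge_is, eflips. intros [[-> ->] | [-> ->]]; split; auto using flips_sym.
Qed.

(** Around a cycle each event is flipped an even number of times, and [a <> c] and [b <> d] prevent
    two consecutive edges from flipping the same event. *)
Lemma square_opposite a b c d e f :
  flips a b e -> flips b c f -> C4 flip_adj a b c d -> e <> f /\ flips c d e /\ flips d a f.
Proof.
  intros F1 F2 (_ & _ & [g F3] & [h F4] & _ & Nac & _ & _ & Nbd & _).
  assert (Nef : e <> f).
  { intros <-. apply Nac, ext. intros k. destruct (classic (k = e)) as [-> | Nk].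
    - destruct F1 as [F1 _], F2 as [F2 _]. rewrite F2, F1; now destruct (mem a e).
    - now rewrite (flips_eq _ _ _ _ F2 Nk), (flips_eq _ _ _ _ F1 Nk). }
  assert (X : forall k, k = e \/ k = f -> k = g \/ k = h).
  { intros k Hk. apply NNPP; intros N.
    assert (mem c k = mem a k).
    { rewrite (flips_eq _ _ _ k F4), (flips_eq _ _ _ k F3); auto. }
    destruct Hk as [-> | ->].
    - rewrite (flips_eq _ _ _ e F2) in H by auto. now apply (flips_neq _ _ _ F1).
    - rewrite <- (flips_eq _ _ _ f F1) in H by auto. now apply (flips_neq _ _ _ F2). }
  assert (h <> e).
  { intros ->. apply Nbd, ext. intros k. apply flips_sym in F4.
    destruct (classic (k = e)) as [-> | Nk].
    - destruct F1 as [F1 _], F4 as [F4 _]. congruence.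
    - now rewrite (flips_eq _ _ _ _ F4 Nk), (flips_eq _ _ _ _ F1 Nk). }
  destruct (X e) as [<- | <-]; [now left | | contradiction].
  split; auto; split; auto.
  destruct (X f) as [-> | ->]; [now right | contradiction | auto].
Qed.

(** The four corners realise all four combinations of [e] and [f]. *)
Lemma square_both a b c d e f : flips a b e -> flips b c f -> C4 flip_adj a b c d ->
  exists w, mem w e = true /\ mem w f = true.
Proof.
  intros F1 F2 Q. destruct (square_opposite _ _ _ _ _ _ F1 F2 Q) as (N & F3 & F4).
  assert (A1 := proj1 F1). assert (A2 := proj1 F2).
  assert (A4 := proj1 (flips_sym _ _ _ F4)).
  assert (B1 := flips_eq _ _ _ f F1 (not_eq_sym N)). assert (B2 := flips_eq _ _ _ e F2 N).
  assert (B4 := flips_eq _ _ _ e F4 N). rewrite B1 in A2.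
  destruct (mem a e) eqn:X, (mem a f) eqn:Y; simpl in *;
    [exists a | exists d | exists b | exists c]; split; congruence.
Qed.

(** A geodesic from [p] to [q] flips [e] somewhere, and it never touches a coordinate on which [p]
    and [q] agree. *)
Lemma cross_edge n p q e : diff_card p q n -> mem p e <> mem q e ->
  exists x y, flips x y e /\ mem x e = mem p e /\
              forall g, mem p g = mem q g -> mem x g = mem p g.
Proof.
  revert p; induction n as [| n IH]; intros p D Ne.
  - destruct D as ([|] & _ & L & Hl); [| discriminate]. now apply Hl in Ne.
  - destruct (step_towards p q) as (p' & g & F & Ng); [congruence|].
    destruct (classic (g = e)) as [-> | Nge].
    + exists p, p'; auto.
    + destruct (diff_card_unflip _ _ _ _ _ F Ng D) as (m & Hm & D'). injection Hm as <-.
      assert (Q := flips_eq _ _ _ _ F (not_eq_sym Nge)).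
      destruct (IH p' D') as (x & y & Fx & Ex & Bx); [now rewrite Q|].
      exists x, y; split; auto. split; [now rewrite Ex|].
      intros k Hk. assert (k <> g) by (intros ->; contradiction).
      rewrite <- (flips_eq _ _ _ _ F H) in *. auto.
Qed.

(** The fourth quadrant is filled by [o]. One edge flipping [e] is found where [f] is present and
    one where [f] is absent; a square is then built between them. *)
Lemma quadrants_cross e f p11 p01 p10 :
  e <> f -> mem p11 e = true -> mem p11 f = true -> mem p01 e = false -> mem p01 f = true ->
  mem p10 e = true -> mem p10 f = false -> cross flip_adj (cls e) (cls f).
Proof.
  intros N A1 A2 B1 B2 C1 C2.
  destruct (diff_card_ex p11 p01) as [n D1], (diff_card_ex p10 o) as [m D2].
  destruct (cross_edge n p11 p01 e D1) as (x1 & y1 & F1 & E1 & I1); [congruence|].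
  destruct (cross_edge m p10 o e D2) as (x2 & y2 & F2 & E2 & I2);
    [rewrite mem_o; congruence|].
  assert (Hx1 : mem x1 f = true) by (rewrite I1; congruence).
  assert (Hx2 : mem x2 f = false) by (rewrite I2; rewrite ?mem_o; congruence).
  assert (Hy1 : mem y1 f = true) by (rewrite (flips_eq _ _ _ f F1); auto).
  assert (Hy2 : mem y2 f = false) by (rewrite (flips_eq _ _ _ f F2); auto).
  assert (Ey1 : mem y1 e = false) by (rewrite (proj1 F1), E1, A1; auto).
  assert (Ey2 : mem y2 e = false) by (rewrite (proj1 F2), E2, C1; auto).
  (* Both [y1] and [y2] lack [e] but they disagree on [f], so a geodesic between them contains an
     edge flipping [f]. *)
  destruct (diff_card_ex y1 y2) as [k D3].
  destruct (cross_edge k y1 y2 f D3) as (w & w' & F3 & E3 & I3); [congruence|].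
  assert (I3' : forall g, mem y1 g = mem y2 g -> mem w' g = mem y1 g).
  { intros g Hg. rewrite (flips_eq _ _ _ g F3); auto. intros ->; congruence. }
  (* The majority with [x1] and [x2], which both contain [e], adds [e] to [v]; the other coordinates
     stay, as [v] lies between [y1] and [y2]. *)
  assert (Lift : forall v, (forall g, mem y1 g = mem y2 g -> mem v g = mem y1 g) ->
            exists v', flips v v' e).
  { intros v Iv. destruct (maj v x1 x2) as [v' Hv']. exists v'; split.
    - rewrite Hv', E1, E2, A1, C1, Iv, Ey1 by congruence. reflexivity.
    - intros g Ng. rewrite Hv'.
      rewrite <- (flips_eq _ _ _ _ F1 Ng), <- (flips_eq _ _ _ _ F2 Ng).
      specialize (Iv g). destruct (mem y1 g), (mem y2 g), (mem v g); simpl; intuition. }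
  destruct (Lift w I3) as [v Fv], (Lift w' I3') as [v' Fv'].
  assert (F4 : flips v' v f).
  { split.
    - rewrite (flips_eq _ _ _ _ Fv'), (flips_eq _ _ _ _ Fv), (proj1 F3) by auto.
      now destruct (mem w f).
    - intros g Ng. destruct (classic (g = e)) as [-> | Nge].
      + rewrite (proj1 Fv), (proj1 Fv'), (flips_eq _ _ _ _ F3); auto.
      + rewrite (flips_eq _ _ _ _ Fv), (flips_eq _ _ _ _ Fv'), (flips_eq _ _ _ _ F3); auto. }
  apply flips_sym in Fv.
  assert (Vne : mem v e = true).
  { apply flips_sym in Fv. now rewrite (proj1 Fv), I3, Ey1 by congruence. }
  assert (V'e : mem v' e = true).
  { now rewrite (proj1 Fv'), I3', Ey1 by congruence. }
  assert (We : mem w e = false) by (rewrite I3; congruence).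
  assert (W'e : mem w' e = false) by (rewrite I3'; congruence).
  exists v, w, w', v'. split.
  - repeat split; try (eexists; eassumption); intros Q; subst; try congruence.
    + now apply flips_neq in F4.
    + now apply flips_neq in F3.
  - destruct (edge_of_flip _ _ _ Fv) as (u1 & P1 & Q1 & R1).
    destruct (edge_of_flip _ _ _ F3) as (u2 & P2 & Q2 & R2).
    destruct (edge_of_flip _ _ _ Fv') as (u3 & P3 & Q3 & R3).
    destruct (edge_of_flip _ _ _ F4) as (u4 & P4 & Q4 & R4).
    exists u1, u2, u3, u4. unfold edge_is. intuition.
Qed.

Lemma cross_both e f : cross flip_adj (cls e) (cls f) ->
  exists w, mem w e = true /\ mem w f = true.
Proof.
  intros (a & b & c & d & Q & f1 & f2 & f3 & f4 & D1 & D2 & D3 & D4 & R1 & R3 & R2 & R4).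
  apply (edge_is_flips _ _ _ _ D1) in R1. apply (edge_is_flips _ _ _ _ D2) in R2.
  eapply square_both; eauto.
Qed.

Lemma cross_not_le e f : cross flip_adj (cls e) (cls f) -> ~ le_ev e f /\ ~ le_ev f e.
Proof.
  intros (a & b & c & d & Q & f1 & f2 & f3 & f4 & D1 & D2 & D3 & D4 & R1 & R3 & R2 & R4).
  apply (edge_is_flips _ _ _ _ D1) in R1. apply (edge_is_flips _ _ _ _ D2) in R2.
  apply (edge_is_flips _ _ _ _ D3) in R3. apply (edge_is_flips _ _ _ _ D4) in R4.
  simpl in *.
  destruct (square_opposite _ _ _ _ _ _ R1 R2 Q) as (N & _).
  assert (A1 := proj1 R1). assert (A2 := proj1 R2).
  assert (A3 := proj1 R3). assert (A4 := proj1 R4).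
  assert (B1 := flips_eq _ _ _ f R1 (not_eq_sym N)). assert (B2 := flips_eq _ _ _ e R2 N).
  assert (B3 := flips_eq _ _ _ f R3 (not_eq_sym N)). assert (B4 := flips_eq _ _ _ e R4 N).
  split; intros L; generalize (L a), (L b), (L c), (L d); intros;
    destruct (mem a e), (mem a f), (mem b e), (mem b f), (mem c e), (mem c f),
      (mem d e), (mem d f); simpl in *; intuition congruence.
Qed.

(** * Halfspaces, order, conflict and independence *)

Lemma event_mem e : exists x y, flips x y e /\ mem x e = false /\ mem y e = true.
Proof.
  destruct (edge_ex e) as (x & y & F). assert (A := proj1 F).
  destruct (mem x e) eqn:X; [exists y, x | exists x, y]; auto using flips_sym.
Qed.

(** As [o] is the empty set, the end of an edge farther from it is the one containing the flipped
    event. *)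
Lemma in_B_iff e w : in_B flip_adj o (cls e) w <-> mem w e = true.
Proof.
  split.
  - intros (u & Hu & L1 & L2). apply (dist_flip_lt _ _ _ _ Hu) in L1.
    rewrite mem_o in L1. rewrite (dist_sym w), (dist_sym w) in L2.
    apply (dist_flip_lt _ _ _ _ (flips_sym _ _ _ Hu)) in L2.
    rewrite <- L2, (proj1 Hu), L1. reflexivity.
  - intros H. destruct (event_mem e) as (x & y & F & Hx & Hy).
    destruct (edge_of_flip _ _ _ F) as (u & P & Q & Fu).
    exists u; split; [exact Fu|]. rewrite P, Q. split.
    + apply (dist_flip_lt _ _ _ _ F). now rewrite mem_o.
    + rewrite (dist_sym w), (dist_sym w).
      apply (dist_flip_lt _ _ _ _ (flips_sym _ _ _ F)). congruence.
Qed.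

(** A member containing [f] but not [e] would give, on a geodesic to [o], an edge flipping [f]
    outside [e], against separation. Conversely, the ends of an edge flipping [f] agree on [e], and
    one of them contains [f]. *)
Lemma ev_le_iff e f : ev_le flip_adj o (cls e) (cls f) <-> le_ev e f.
Proof.
  split.
  - intros [H | [_ H]].
    + apply cls_inj in H; subst; intros x; auto.
    + intros p Hp. apply NNPP; intros Ne.
      destruct (diff_card_ex p o) as [n D].
      destruct (cross_edge n p o f D) as (x & y & F & Ex & Ix);
        [rewrite mem_o; congruence|].
      destruct (edge_of_flip _ _ _ F) as (u & P & Q & Fu).
      destruct (H u Fu) as [H1 _]. rewrite P in H1. apply in_B_iff in H1.
      rewrite Ix in H1; [contradiction|]. rewrite mem_o. now destruct (mem p e).
  - intros L. destruct (classic (e = f)) as [-> | N]; [now left | right]. split.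
    + intros C. now apply cross_not_le in C.
    + intros u Fu. rewrite !in_B_iff. cbn in Fu. assert (A := proj1 Fu).
      assert (B := flips_eq _ _ _ _ Fu N).
      destruct (mem (e1 flip_adj u) f) eqn:X; simpl in A.
      * rewrite B; split; now apply L.
      * rewrite <- B; split; now apply L.
Qed.

(** Incomparability fills the two mixed quadrants, so a common member would force a crossing. *)
Lemma ev_conf_iff e f : ev_conf flip_adj o (cls e) (cls f) <-> conf_ev e f.
Proof.
  assert (S : forall e f, e <> f -> ~ separates flip_adj o (cls e) (cls f) -> ~ le_ev e f).
  { intros e' f' N H L. apply ev_le_iff in L. destruct L as [L | L]; auto.
    now apply cls_inj in L. }
  assert (W : forall e f, ~ le_ev e f -> exists x, mem x f = true /\ mem x e = false).
  { intros e' f' L. apply not_all_ex_not in L. destruct L as [x L]. exists x.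
    destruct (mem x f'), (mem x e'); intuition congruence. }
  split.
  - intros (N & C & S1 & S2).
    assert (N' : e <> f) by congruence. split; auto. intros p P1 P2. apply C.
    destruct (W _ _ (S _ _ N' S1)) as (x & X1 & X2).
    destruct (W _ _ (S _ _ (not_eq_sym N') S2)) as (y & Y1 & Y2).
    exact (quadrants_cross e f p x y N' P1 P2 X2 X1 Y1 Y2).
  - intros (N & C). repeat split.
    + intros Q; now apply cls_inj in Q.
    + intros X. apply cross_both in X. destruct X as (w & W1 & W2). eauto.
    + intros X. assert (L : le_ev e f) by (apply ev_le_iff; now right).
      destruct (event_mem f) as (x & y & _ & _ & Y). eauto.
    + intros X. assert (L : le_ev f e) by (apply ev_le_iff; now right).
      destruct (event_mem e) as (x & y & _ & _ & Y). eauto.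
Qed.

(** Minimality of a conflict quantifies over all classes, so the transfer rests on [cls_surj]. *)
Lemma independent_cls e f :
  independent (ev_le flip_adj o) (ev_conf flip_adj o) (cls e) (cls f) <->
  independent le_ev conf_ev e f.
Proof.
  unfold independent, concurrent, minimal_conflict.
  rewrite !ev_le_iff, ev_conf_iff.
  enough (X : (exists C, C <> cls e /\ C <> cls f /\
     ((ev_le flip_adj o C (cls e) /\ ev_conf flip_adj o C (cls f)) \/
      (ev_le flip_adj o C (cls f) /\ ev_conf flip_adj o C (cls e)))) <->
     (exists g, g <> e /\ g <> f /\
     ((le_ev g e /\ conf_ev g f) \/ (le_ev g f /\ conf_ev g e)))) by tauto.
  split.
  - intros (C & N1 & N2 & H). destruct (cls_surj C) as [g ->]. exists g.
    rewrite !ev_le_iff, !ev_conf_iff in H. repeat split; auto; congruence.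
  - intros (g & N1 & N2 & H). exists (cls g). rewrite !ev_le_iff, !ev_conf_iff.
    repeat split; auto; intros Q; now apply cls_inj in Q.
Qed.

Lemma list_cls (l : list (theta_class flip_adj)) : exists k, l = map cls k.
Proof.
  induction l as [| C l [k ->]]; [now exists nil|].
  destruct (cls_surj C) as [e ->]. now exists (e :: k).
Qed.

Lemma pairwise_independent_cls l :
  pairwise_independent (ev_le flip_adj o) (ev_conf flip_adj o) (map cls l) <->
  pairwise_independent le_ev conf_ev l.
Proof.
  split; intros [N H]; split.
  - now apply NoDup_map_inv in N.
  - intros e f He Hf Q. apply independent_cls. apply H; auto using in_map.
    intros X; now apply cls_inj in X.
  - apply Injective_map_NoDup; auto. intros e f; apply cls_inj.
  - intros C D HC HD Q. apply in_map_iff in HC, HD.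
    destruct HC as (e & <- & He), HD as (f & <- & Hf).
    apply independent_cls. apply H; auto. congruence.
Qed.

(** * Enabled events, out-degree and contact *)

Definition enabled (x : V) (e : E) : Prop :=
  mem x e = false /\ exists y, flips x y e.

(** A cause [g] of [e], different from both events, already belongs to [x], hence to the vertex
    obtained by adding [f]; so it cannot conflict with [f]. *)
Lemma enabled_independent x e f :
  enabled x e -> enabled x f -> e <> f -> independent le_ev conf_ev e f.
Proof.
  intros [He [y Fy]] [Hf [z Fz]] N.
  assert (Ye : mem y e = true) by (rewrite (proj1 Fy), He; auto).
  assert (Zf : mem z f = true) by (rewrite (proj1 Fz), Hf; auto).
  assert (Yf : mem y f = false) by (rewrite (flips_eq _ _ _ _ Fy); auto).
  assert (Ze : mem z e = false) by (rewrite (flips_eq _ _ _ _ Fz); auto).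
  assert (L1 : ~ le_ev e f) by (intros L; apply L in Zf; congruence).
  assert (L2 : ~ le_ev f e) by (intros L; apply L in Ye; congruence).
  destruct (classic (conf_ev e f)) as [C | C]; [right; split; auto | now left].
  intros (g & N1 & N2 & [[L [_ Q]] | [L [_ Q]]]).
  - apply L in Ye. apply (Q z); auto.
    now rewrite (flips_eq _ _ _ _ Fz), <- (flips_eq _ _ _ g Fy).
  - apply L in Zf. apply (Q y); auto.
    now rewrite (flips_eq _ _ _ _ Fy), <- (flips_eq _ _ _ g Fz).
Qed.

Lemma out_nb_iff x y : out_nb flip_adj o x y <-> exists e, mem x e = false /\ flips x y e.
Proof.
  split.
  - intros [[e F] L]. exists e; split; auto. apply (dist_flip_lt _ _ _ _ F) in L.
    now rewrite mem_o in L.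
  - intros (e & H & F). split; [now exists e|].
    apply (dist_flip_lt _ _ _ _ F). now rewrite mem_o.
Qed.

Lemma flips_det x y z e : flips x y e -> flips x z e -> y = z.
Proof.
  intros F G. apply ext; intros g. destruct (classic (g = e)) as [-> | N].
  - now rewrite (proj1 F), (proj1 G).
  - now rewrite (flips_eq _ _ _ _ F N), (flips_eq _ _ _ _ G N).
Qed.

(** Out-edges at a vertex correspond to the events enabled there, and these are pairwise
    independent. One bound therefore serves both numbers, and one vertex attains both. *)
Lemma degree_outdeg k x :
  (forall l, pairwise_independent le_ev conf_ev l -> length l <= k) ->
  (exists l, NoDup l /\ length l = k /\ forall e, In e l -> enabled x e) ->
  max_outdeg_eq flip_adj o k /\ degree_eq (ev_le flip_adj o) (ev_conf flip_adj o) k.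
Proof.
  intros B (l & Nl & Ll & Hl). split; split.
  - intros z ys Ny Hy.
    assert (X : exists es, length es = length ys /\ NoDup es /\
      forall e, In e es -> mem z e = false /\ exists y, In y ys /\ flips z y e).
    { clear l Nl Ll Hl. induction ys as [| y ys IH].
      - exists nil; repeat split; [constructor | |]; elim H.
      - inversion Ny; subst. destruct IH as (es & Le & Ne & He); auto.
        { intros; apply Hy; now right. }
        destruct (proj1 (out_nb_iff z y) (Hy y (or_introl eq_refl))) as (e & Q & F).
        exists (e :: es); repeat split; simpl.
        + now f_equal.
        + constructor; auto. intros I. apply He in I. destruct I as (_ & y' & I & F').
          now rewrite (flips_det _ _ _ _ F F') in H1.
        + destruct H as [<- | H]; auto. now apply He.
        + destruct H as [<- | H]; [exists y; auto|].
          apply He in H. destruct H as (_ & y' & I & F'). eauto. }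
    destruct X as (es & <- & Ne & He). apply B. split; auto.
    intros e f Ie If N. apply He in Ie, If.
    destruct Ie as (Qe & y & _ & Fe), If as (Qf & y' & _ & Ff).
    apply (enabled_independent z); auto; split; eauto.
  - exists x.
    assert (X : exists ys, length ys = length l /\ NoDup ys /\
      forall y, In y ys -> exists e, In e l /\ mem x e = false /\ flips x y e).
    { clear Ll. induction l as [| e l IH].
      - exists nil; repeat split; [constructor |]; intros ? [].
      - inversion Nl; subst. destruct IH as (ys & Ly & Ny & Hy); auto.
        { intros; apply Hl; now right. }
        destruct (Hl e (or_introl eq_refl)) as (Q & y & F).
        exists (y :: ys); repeat split; simpl.
        + now f_equal.
        + constructor; auto. intros I. apply Hy in I. destruct I as (e' & I & _ & F').
          now rewrite (flips_fun _ _ _ _ F F') in H1.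
        + intros z [<- | I]; [exists e; auto|].
          apply Hy in I. destruct I as (e' & I & R). eauto. }
    destruct X as (ys & Ly & Ny & Hy). exists ys; repeat split; auto; [| | congruence].
    + destruct (Hy y H) as (e & _ & R). apply (out_nb_iff x y); eauto.
    + destruct (Hy y H) as (e & _ & R). apply (out_nb_iff x y); eauto.
  - intros cs Hc. destruct (list_cls cs) as [es ->]. rewrite length_map. apply B.
    now apply pairwise_independent_cls.
  - exists (map cls l). rewrite length_map; split; auto.
    apply pairwise_independent_cls. split; auto.
    intros e f Ie If N. apply (enabled_independent x); auto.
Qed.

(** A square through both edges would have a corner containing both events, which the conflict
    excludes. *)
Lemma enabled_contact x e f :
  enabled x e -> enabled x f -> conf_ev e f -> contact_adj flip_adj o (cls e) (cls f).
Proof.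
  intros [He [y Fy]] [Hf [z Fz]] [N C]. split.
  { intros Q; now apply cls_inj in Q. }
  right.
  destruct (edge_of_flip _ _ _ Fy) as (u & P1 & P2 & Fu).
  destruct (edge_of_flip _ _ _ Fz) as (w & Q1 & Q2 & Fw).
  exists u, w. split; [exact Fu|]. split; [exact Fw|]. split.
  - assert (O : forall t g, eflips t g -> mem (e1 flip_adj t) g = false ->
                  origin flip_adj o t = e1 flip_adj t).
    { intros t g Ft Ht. unfold origin.
      assert (dist flip_adj (e1 flip_adj t) o < dist flip_adj (e2 flip_adj t) o).
      { apply (dist_flip_lt _ _ _ _ Ft). now rewrite mem_o. }
      apply Nat.ltb_lt in H. now rewrite H. }
    rewrite (O u e), (O w f); auto; congruence.
  - intros (a & b & c & d & Sq & Iu & Iw).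
    assert (Sq' := Sq). destruct Sq' as ([g Fg] & [h Fh] & _).
    destruct (square_opposite _ _ _ _ _ _ Fg Fh Sq) as (Ngh & Fg' & Fh').
    assert (X : forall t k, eflips t k -> on_C4 flip_adj t a b c d -> k = g \/ k = h).
    { intros t k Ft [I | [I | [I | I]]]; apply (edge_is_flips _ _ _ _ I) in Ft;
        [left | right | left | right]; eapply flips_fun; eauto. }
    destruct (square_both _ _ _ _ _ _ Fg Fh Sq) as (v & V1 & V2).
    destruct (X u e Fu Iu) as [-> | ->], (X w f Fw Iw) as [-> | ->];
      try congruence; eauto.
Qed.

End MedianSystem.

(** * The binary tree and its medians *)

(* Words are read from the right: the children of [t] are [true :: t] and [false :: t]. *)
Definition word : Type := list bool.

Lemma word_eq_dec (s t : word) : {s = t} + {s <> t}.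
Proof. exact (list_eq_dec bool_dec s t). Qed.

Fixpoint anc (s t : word) : bool :=
  if word_eq_dec s t then true
  else match t with nil => false | _ :: t' => anc s t' end.

Lemma anc_refl s : anc s s = true.
Proof. destruct s; simpl; destruct word_eq_dec; auto. Qed.

Lemma anc_cons s b t : anc s (b :: t) = true <-> s = b :: t \/ anc s t = true.
Proof.
  simpl. destruct word_eq_dec; [tauto|].
  split; [tauto | intros [-> |]; auto; contradiction].
Qed.

Lemma anc_iff s t : anc s t = true <-> exists r, t = r ++ s.
Proof.
  split.
  - induction t as [| b t IH]; intros H.
    + simpl in H. destruct word_eq_dec; [subst; now exists nil | discriminate].
    + apply anc_cons in H. destruct H as [-> | H]; [now exists nil|].
      destruct (IH H) as [r ->]. now exists (b :: r).
  - intros [r ->]. induction r as [| b r IH]; [apply anc_refl|].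
    apply anc_cons; now right.
Qed.

Lemma anc_nil t : anc nil t = true.
Proof. apply anc_iff. exists t. now rewrite app_nil_r. Qed.

Lemma anc_length s t : anc s t = true -> length s <= length t.
Proof. rewrite anc_iff. intros [r ->]. rewrite length_app; lia. Qed.

Lemma anc_trans r s t : anc r s = true -> anc s t = true -> anc r t = true.
Proof. rewrite !anc_iff. intros [x ->] [y ->]. exists (y ++ x). now rewrite app_assoc. Qed.

Lemma anc_antisym s t : anc s t = true -> anc t s = true -> s = t.
Proof.
  intros H1 H2. apply anc_length in H2. apply anc_iff in H1. destruct H1 as [[| b r] ->]; auto.
  rewrite length_app in H2; simpl in H2; lia.
Qed.

Lemma anc_chain s s' t :
  anc s t = true -> anc s' t = true -> length s <= length s' -> anc s s' = true.
Proof.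
  induction t as [| b t IH]; intros H H' L.
  - apply anc_length in H, H'. destruct s, s'; try (simpl in *; lia); apply anc_refl.
  - apply anc_cons in H, H'. destruct H' as [-> | H'].
    + now apply anc_cons.
    + destruct H as [-> | H]; auto. apply anc_length in H'. simpl in L; lia.
Qed.

Lemma anc_meet x y : exists m, forall s, anc s m = anc s x && anc s y.
Proof.
  induction x as [| b x [m Hm]].
  - exists nil; intros s. destruct (anc s nil) eqn:H; auto.
    apply anc_iff in H. destruct H as [r H]. symmetry in H. apply app_eq_nil in H.
    destruct H as [_ ->]. now rewrite anc_nil.
  - destruct (anc (b :: x) y) eqn:H.
    + exists (b :: x). intros s. destruct (anc s (b :: x)) eqn:Q; auto.
      now rewrite (anc_trans _ _ _ Q H).
    + exists m. intros s. rewrite Hm. simpl. destruct word_eq_dec as [-> |]; auto.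
      rewrite H; simpl. now rewrite andb_false_r.
Qed.

(** Any two of the three pairwise meets are ancestors of a common node, so the meets form a chain.
    The ancestors of the deepest meet are the nodes above at least two of [x], [y], [z]. *)
Lemma anc_maj x y z : exists m, forall s, anc s m = majb (anc s x) (anc s y) (anc s z).
Proof.
  destruct (anc_meet x y) as [m1 H1], (anc_meet y z) as [m2 H2], (anc_meet z x) as [m3 H3].
  assert (I : forall m u v, (forall s, anc s m = anc s u && anc s v) ->
                anc m u = true /\ anc m v = true).
  { intros m u v H. apply andb_true_iff. rewrite <- H. apply anc_refl. }
  destruct (I _ _ _ H1) as [A1 B1], (I _ _ _ H2) as [A2 B2], (I _ _ _ H3) as [A3 B3].
  assert (J : forall s m u, anc m u = true -> anc s m = true -> anc s u = true)
    by (intros s m u Q1 Q2; exact (anc_trans _ _ _ Q2 Q1)).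
  assert (M : exists m, (m = m1 \/ m = m2 \/ m = m3) /\
     length m1 <= length m /\ length m2 <= length m /\ length m3 <= length m).
  { destruct (le_lt_dec (length m1) (length m2)), (le_lt_dec (length m2) (length m3)),
      (le_lt_dec (length m1) (length m3));
      solve [exists m1; intuition lia | exists m2; intuition lia | exists m3; intuition lia]. }
  destruct M as (m & M & L1 & L2 & L3).
  assert (C : anc m1 m = true /\ anc m2 m = true /\ anc m3 m = true).
  { destruct M as [-> | [-> | ->]]; rewrite ?anc_refl; repeat split; auto;
      solve [apply (anc_chain _ _ x); auto | apply (anc_chain _ _ y); auto
            | apply (anc_chain _ _ z); auto]. }
  destruct C as (C1 & C2 & C3). exists m. intros s.
  specialize (J s). generalize (J _ _ C1), (J _ _ C2), (J _ _ C3).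
  rewrite H1, H2, H3.
  destruct M as [-> | [-> | ->]]; rewrite ?H1, ?H2, ?H3;
    destruct (anc s x), (anc s y), (anc s z); simpl; intuition congruence.
Qed.

(** * Intervals and the on-line game *)

(* The second component of [of_nat n] is ignored, so that every interval recurs. *)
Definition lo (n : nat) : nat := fst (of_nat (fst (of_nat n))).
(** Decoding an offset rather than an end makes every code a nonempty interval. *)
Definition hi (n : nat) : nat := lo n + snd (of_nat (fst (of_nat n))).

Lemma lo_hi n : lo n <= hi n.
Proof. unfold hi; lia. Qed.

(** Lets a play wait, at any stage, for the interval it needs. *)
Lemma interval_often a b n : a <= b -> exists m, n <= m /\ lo m = a /\ hi m = b.
Proof.
  intros H. exists (to_nat (to_nat (a, b - a), n)).
  pose proof (to_nat_non_decreasing (to_nat (a, b - a)) n).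
  unfold hi, lo. rewrite !cancel_of_to; cbn [fst]; rewrite !cancel_of_to; simpl; lia.
Qed.

Definition lw (u : word) : nat := lo (length u).
Definition hw (u : word) : nat := hi (length u).

Definition meets (u v : word) : Prop := lw u <= hw v /\ lw v <= hw u.

Definition disjointb (u v : word) : bool := (hw u <? lw v) || (hw v <? lw u).

Lemma disjointb_iff u v : disjointb u v = true <-> ~ meets u v.
Proof.
  unfold disjointb, meets. rewrite orb_true_iff, !Nat.ltb_lt. lia.
Qed.

(* The move [true] at node [t] creates a set, named [t], with interval [[lw t, hw t]];
   at the following move all older sets meeting this interval are discarded.
   [settled t] lists the sets which survive the discarding at [t]. *)
Fixpoint settled (t : word) : list word :=
  match t with
  | nil => nil
  | true :: t' => t' :: filter (disjointb t') (settled t')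
  | false :: t' => settled t'
  end.

(** Here the last move has created its set but discarded nothing yet: a new set and the older sets
    that it meets coexist at the node of its birth. *)
Definition alive (t : word) : list word :=
  match t with
  | nil => nil
  | true :: t' => t' :: settled t'
  | false :: t' => settled t'
  end.

Lemma settled_alive u t : In u (settled t) -> In u (alive t).
Proof.
  destruct t as [| [] t]; simpl; auto. intros [-> | H]; auto. apply filter_In in H; tauto.
Qed.

Lemma alive_cons u b t : In u (alive (b :: t)) -> true :: u = b :: t \/ In u (settled t).
Proof. destruct b; simpl; auto. intros [-> |]; auto. Qed.

Lemma alive_anc u t : In u (alive t) -> anc (true :: u) t = true.
Proof.
  induction t as [| b t IH]; [intros []|]. intros H. apply anc_cons.
  apply alive_cons in H. destruct H as [H | H]; auto using settled_alive.
Qed.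

Lemma settled_length u t : In u (settled t) -> length u < length t.
Proof. intros H. apply settled_alive, alive_anc, anc_length in H. exact H. Qed.

(** A set enters only at its birth and never returns once discarded, so its lifetime along a branch
    has no gap. *)
Lemma alive_convex u x m :
  In u (alive x) -> anc m x = true -> anc (true :: u) m = true -> In u (alive m).
Proof.
  induction x as [| b x IH]; [intros []|]. intros H A B.
  apply anc_cons in A. destruct A as [-> | A]; auto.
  apply alive_cons in H. destruct H as [H | H]; auto using settled_alive.
  exfalso. apply (anc_trans _ _ _ B) in A. apply anc_length in A. rewrite H in A.
  simpl in A; lia.
Qed.

(** A new set removes everything that it meets. This is what limits overlaps to pairs. *)
Lemma settled_disjoint t u v :
  In u (settled t) -> In v (settled t) -> u <> v -> ~ meets u v.
Proof.
  induction t as [| [] t IH]; simpl; auto.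
  rewrite !filter_In, !disjointb_iff. unfold meets.
  intros [<- | [H H']] [<- | [K K']] N; auto; tauto.
Qed.

Lemma settled_falses n t : settled (repeat false n ++ t) = settled t.
Proof. induction n; auto. Qed.

(** * Forcing many colours *)

Section Colouring.

Context (f : word -> nat).
Context (proper : forall u v, In v (settled u) -> meets u v -> f u <> f v).

(* In free time [[a, a + N)], growing the tree below [t] forces [k] colours on settled
   sets living to the right of a still free window of length [M]. In the inductive step
   the strategy is run inside its own free window; if it produces no new colour, then a
   set meeting all sets of the inner run supplies one. *)
Lemma colour_forcing k : forall M, exists N, forall t a,
  (forall u, In u (settled t) -> hw u < a \/ a + N <= lw u) ->
  exists t' a' L, a <= a' /\ a' + M <= a + N /\
    (forall u, In u (settled t) -> hw u < a \/ a + N <= lw u -> In u (settled t')) /\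
    (forall u, In u (settled t') -> hw u < a' \/ a' + M <= lw u) /\
    length L = k /\ NoDup (map f L) /\
    (forall u, In u L -> In u (settled t') /\ a' + M <= lw u /\ hw u < a + N).
Proof.
  induction k as [| k IH]; intros M.
  { exists M. intros t a Fr. exists t, a, nil. simpl.
    repeat split; auto; solve [constructor | contradiction]. }
  (* The outer run leaves a window of length [N2] for the inner one. The inner run leaves [S M]
     rather than [M], so that the interval from [a2 + M] to [a1 + N2 - 1] used below is nonempty. *)
  destruct (IH (S M)) as [N2 H2], (IH N2) as [N1 H1]. exists N1. intros t a Fr.
  destruct (H1 t a Fr) as (t1 & a1 & L1 & A1 & B1 & K1 & Fr1 & C1 & D1 & P1).
  destruct (H2 t1 a1 Fr1) as (t2 & a2 & L2 & A2 & B2 & K2 & Fr2 & C2 & D2 & P2).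
  assert (P1' : forall u, In u L1 -> In u (settled t2)).
  { intros u Hu. destruct (P1 u Hu) as (Q1 & Q2 & _). apply K2; auto. }
  destruct (classic (exists u, In u L2 /\ ~ In (f u) (map f L1))) as [(u & Hu & Nu) | No].
  { exists t2, a2, (u :: L1). repeat split; try lia.
    - intros v Hv Dv. apply K2; [now apply K1 | lia].
    - intros v Hv. apply Fr2 in Hv; lia.
    - simpl; congruence.
    - simpl; now constructor.
    - destruct H as [<- | H]; [now apply P2 | auto].
    - destruct H as [<- | H]; [apply P2 in Hu | apply P1 in H]; lia.
    - destruct H as [<- | H]; [apply P2 in Hu | apply P1 in H]; lia. }
  (* Both runs show [k] distinct colours, so if the inner run brings no new one the two colour sets
     coincide. *)
  assert (Inc : incl (map f L1) (map f L2)).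
  { apply NoDup_length_incl; auto; [rewrite !length_map; lia|].
    intros c Hc. apply in_map_iff in Hc. destruct Hc as (u & <- & Hu).
    apply NNPP; intros Nu; eauto. }
  (* This interval contains all sets of [L2], whose colours it must avoid, but it misses the sets of
     [L1] and the final window of length [M]. *)
  destruct (interval_often (a2 + M) (a1 + N2 - 1) (length t2)) as (m & Lm & Hlo & Hhi);
    [lia|].
  (* Moves [false] create nothing and leave the settled sets unchanged while the play waits for move
     number [m]. *)
  set (d := repeat false (m - length t2) ++ t2).
  assert (Ld : lw d = a2 + M /\ hw d = a1 + N2 - 1).
  { unfold lw, hw, d. rewrite length_app, repeat_length.
    replace (m - length t2 + length t2) with m by lia. auto. }
  destruct Ld as [Ld Hd].
  assert (Sd : settled d = settled t2) by apply settled_falses.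
  assert (Kd : forall u, In u (settled t2) -> hw u < a1 \/ a1 + N2 <= lw u ->
                 In u (settled (true :: d))).
  { intros u Hu Du. simpl. right. rewrite Sd. apply filter_In; split; auto.
    apply disjointb_iff. unfold meets. lia. }
  exists (true :: d), a2, (d :: L1). repeat split; try lia.
  - intros u Hu Du. apply Kd; [| lia]. apply K2; [now apply K1 | lia].
  - intros u [<- | Hu]; [lia|]. rewrite Sd in Hu. apply filter_In in Hu.
    destruct Hu as [Hu _]. apply Fr2 in Hu. lia.
  - simpl; congruence.
  - simpl; constructor; auto. intros I. apply Inc in I. apply in_map_iff in I.
    destruct I as (u & E & Hu). apply P2 in Hu. destruct Hu as (Hu & Q1 & Q2).
    apply (proper d u); [now rewrite Sd | | auto]. unfold meets.
    pose proof (lo_hi (length u)). fold (lw u) (hw u) in H. lia.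
  - destruct H as [<- | H]; [now left|]. apply Kd; auto. apply P1 in H. lia.
  - destruct H as [<- | H]; [lia|]. apply P1 in H. lia.
  - destruct H as [<- | H]; [lia|]. apply P1 in H. lia.
Qed.

End Colouring.

(** From the empty play, a proper colouring would be forced to show [S n] colours. *)
Lemma colour_unbounded n (f : word -> nat) : (forall u, f u < n) ->
  exists u v, In v (settled u) /\ meets u v /\ f u = f v.
Proof.
  intros B. apply NNPP; intros No.
  destruct (colour_forcing f) with (k := S n) (M := 0) as [N H].
  { intros u v Hv M Q. apply No. eauto. }
  destruct (H nil 0) as (t & a & L & _ & _ & _ & _ & LL & ND & _); [intros ? []|].
  assert (I : incl (map f L) (seq 0 n)).
  { intros c Hc. apply in_map_iff in Hc. destruct Hc as (u & <- & _).
    apply in_seq. specialize (B u). lia. }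
  apply NoDup_incl_length in I; auto. rewrite length_map, length_seq in I. lia.
Qed.

(** * The tree times the ray with prisms, as a median system *)

Definition lift_ok (t : word) (n : nat) (l : option word) : Prop :=
  match l with None => True | Some u => In u (alive t) /\ lw u <= n <= hw u end.

(* The product of the binary tree with the ray, on which each set [u] erects the
   prism over its subtree times interval. *)
Record vertex : Type := Vertex {
  pos : word;
  time : nat;
  lift : option word;
  lift_okP : lift_ok pos time lift }.

(** The three kinds stand for the tree edge from [t] to [b :: t], the ray edge from [n] to [S n],
    and the vertical edges of the prism over [u]. *)
Inductive event : Type :=
| Node (b : bool) (t : word)
| Tick (n : nat)
| Lift (u : word).

Definition mem (x : vertex) (e : event) : bool :=
  match e with
  | Node b t => anc (b :: t) (pos x)
  | Tick n => n <? time x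
  | Lift u => match lift x with
              | Some v => if word_eq_dec u v then true else false
              | None => false
              end
  end.

Lemma mem_lift x u : mem x (Lift u) = true <-> lift x = Some u.
Proof.
  simpl. destruct (lift x) as [v |]; [| split; discriminate].
  destruct word_eq_dec; split; congruence.
Qed.

Lemma vertex_eq x y : pos x = pos y -> time x = time y -> lift x = lift y -> x = y.
Proof.
  destruct x as [t n l p], y as [t' n' l' p']; simpl; intros -> -> ->.
  f_equal. apply proof_irrelevance.
Qed.

Lemma mem_ext x y : (forall e, mem x e = mem y e) -> x = y.
Proof.
  intros H. apply vertex_eq.
  - assert (A : forall s, anc s (pos x) = anc s (pos y)).
    { intros [| b s]; [now rewrite !anc_nil | exact (H (Node b s))]. }
    apply anc_antisym; [rewrite <- A | rewrite A]; apply anc_refl.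
  - generalize (H (Tick (time x))), (H (Tick (time y))); simpl.
    rewrite !Nat.ltb_irrefl. intros Q1 Q2. symmetry in Q1.
    apply Nat.ltb_ge in Q1, Q2. lia.
  - destruct (lift x) as [u |] eqn:X.
    + apply mem_lift in X. rewrite H in X. apply mem_lift in X. auto.
    + destruct (lift y) as [u |] eqn:Y; auto.
      apply mem_lift in Y. rewrite <- H in Y. apply mem_lift in Y. congruence.
Qed.

Lemma nat_maj a b c : exists m, forall n, (n <? m) = majb (n <? a) (n <? b) (n <? c).
Proof.
  exists (Nat.max (Nat.min a b) (Nat.max (Nat.min b c) (Nat.min c a))). intros n.
  destruct (n <? a) eqn:A, (n <? b) eqn:B, (n <? c) eqn:C; simpl;
    rewrite ?Nat.ltb_lt, ?Nat.ltb_ge in *; lia.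
Qed.

(** Two different lifts cannot each be carried by two of three vertices. *)
Lemma lift_maj x y z : exists l : option word,
  forall u, l = Some u <->
    majb (mem x (Lift u)) (mem y (Lift u)) (mem z (Lift u)) = true.
Proof.
  assert (X : forall u, majb (mem x (Lift u)) (mem y (Lift u)) (mem z (Lift u)) = true <->
    (lift x = Some u /\ lift y = Some u) \/ (lift y = Some u /\ lift z = Some u) \/
    (lift z = Some u /\ lift x = Some u)).
  { intros u. rewrite <- !mem_lift.
    destruct (mem x (Lift u)), (mem y (Lift u)), (mem z (Lift u)); simpl;
      intuition congruence. }
  destruct (classic (exists u, majb (mem x (Lift u)) (mem y (Lift u)) (mem z (Lift u)) = true))
    as [[u Hu] | No].
  - exists (Some u). intros v. rewrite X in *. intuition congruence.
  - exists None. intros u; split; [discriminate | intros H; exfalso; eauto].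
Qed.

Lemma lift_ok_between x y t n u :
  lift x = Some u -> lift y = Some u ->
  (forall s, anc s (pos x) = true -> anc s (pos y) = true -> anc s t = true) ->
  (anc t (pos x) = true \/ anc t (pos y) = true) ->
  Nat.min (time x) (time y) <= n <= Nat.max (time x) (time y) -> lift_ok t n (Some u).
Proof.
  destruct x as [t1 n1 l1 p1], y as [t2 n2 l2 p2]; simpl. intros -> -> A B T.
  simpl in *. destruct p1 as [I1 J1], p2 as [I2 J2]. split; [| lia].
  assert (C : anc (true :: u) t = true) by auto using alive_anc.
  destruct B as [B | B]; [exact (alive_convex _ _ _ I1 B C) | exact (alive_convex _ _ _ I2 B C)].
Qed.

(** Medians are taken in each factor. A lift survives only if two of the vertices carry it, and the
    median of the positions then lies over the same set by convexity. *)
Lemma mem_maj x y z : exists m, forall e, mem m e = majb (mem x e) (mem y e) (mem z e).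
Proof.
  destruct (anc_maj (pos x) (pos y) (pos z)) as [t Ht].
  destruct (nat_maj (time x) (time y) (time z)) as [n Hn].
  destruct (lift_maj x y z) as [l Hl].
  assert (K : lift_ok t n l).
  { destruct l as [u |]; [| exact I].
    assert (Q := proj1 (Hl u) eq_refl).
    (* The upper bound on [n] is tested on the event [Tick (n - 1)], which is meaningful only for
       positive [n]. *)
    assert (D : (n = 0 \/ (n - 1 <? n) = true)).
    { destruct n; [now left | right]. apply Nat.ltb_lt; lia. }
    assert (G : forall p q r : vertex,
      mem p (Lift u) = true -> mem q (Lift u) = true ->
      (forall s, anc s t = majb (anc s (pos p)) (anc s (pos q)) (anc s (pos r))) ->
      (forall k, (k <? n) = majb (k <? time p) (k <? time q) (k <? time r)) ->
      lift_ok t n (Some u)).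
    { intros p q r Hp Hq A B. apply mem_lift in Hp, Hq.
      apply (lift_ok_between p q); auto.
      - intros s S1 S2. now rewrite A, S1, S2.
      - specialize (A t). rewrite anc_refl in A.
        destruct (anc t (pos p)), (anc t (pos q)); simpl in A; auto.
      - split.
        + apply Nat.nlt_ge. intros L. specialize (B n).
          rewrite Nat.ltb_irrefl in B.
          assert (C1 : (n <? time p) = true) by (apply Nat.ltb_lt; lia).
          assert (C2 : (n <? time q) = true) by (apply Nat.ltb_lt; lia).
          rewrite C1, C2 in B. discriminate.
        + apply Nat.nlt_ge. intros L. destruct D as [D | D]; [lia|].
          specialize (B (n - 1)). rewrite D in B.
          assert (C1 : (n - 1 <? time p) = false) by (apply Nat.ltb_ge; lia).
          assert (C2 : (n - 1 <? time q) = false) by (apply Nat.ltb_ge; lia).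
          rewrite C1, C2 in B. discriminate. }
    assert (P : forall a b c, majb a b c = majb b c a) by (intros [] [] []; auto).
    destruct (mem x (Lift u)) eqn:X, (mem y (Lift u)) eqn:Y.
    - apply (G x y z); auto.
    - apply (G z x y); auto; intros; rewrite P; auto.
    - apply (G y z x); auto; intros; rewrite <- P; auto.
    - discriminate. }
  exists (Vertex t n l K). intros [b s | k | u]; simpl pos; simpl time.
  - apply Ht.
  - apply Hn.
  - apply eq_iff_eq_true. rewrite mem_lift. apply Hl.
Qed.

(** * Edges, origin and connectedness *)

Definition base (t : word) (n : nat) : vertex := Vertex t n None I.

Definition origin_vertex : vertex := base nil 0.

Lemma mem_origin e : mem origin_vertex e = false.
Proof. destruct e; simpl; auto. now destruct word_eq_dec. Qed.

Lemma flips_node t n b : flips mem (base t n) (base (b :: t) n) (Node b t).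
Proof.
  split.
  - change (anc (b :: t) (b :: t) = negb (anc (b :: t) t)). rewrite anc_refl.
    destruct (anc (b :: t) t) eqn:H; auto. apply anc_length in H. simpl in H; lia.
  - intros [b' t' | k | u] N; auto.
    change (anc (b' :: t') (b :: t) = anc (b' :: t') t). apply eq_iff_eq_true.
    rewrite anc_cons. intuition congruence.
Qed.

Lemma flips_tick t n : flips mem (base t n) (base t (S n)) (Tick n).
Proof.
  split.
  - change ((n <? S n) = negb (n <? n)). rewrite Nat.ltb_irrefl.
    apply Nat.ltb_lt; lia.
  - intros [b' t' | k | u] N; auto. change ((k <? S n) = (k <? n)).
    assert (k <> n) by congruence. apply eq_iff_eq_true. rewrite !Nat.ltb_lt. lia.
Qed.

Lemma flips_lift t n u H : flips mem (base t n) (Vertex t n (Some u) H) (Lift u).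
Proof.
  split.
  - simpl. destruct word_eq_dec; [reflexivity | congruence].
  - intros [b' t' | k | v] N; auto. simpl. destruct word_eq_dec; congruence.
Qed.

(** The way to the origin drops the lift, then climbs to the root of the tree, then runs time back
    to zero. *)
Lemma vertex_connected x : exists n, walk (flip_adj mem) x origin_vertex n.
Proof.
  assert (B : forall t n, exists k, walk (flip_adj mem) (base t n) origin_vertex k).
  { induction t as [| b t IH]; intros n.
    - induction n as [| n [k W]]; [exists 0; constructor|].
      exists (S k). econstructor; [| exact W]. eexists. apply flips_sym, flips_tick.
    - destruct (IH n) as [k W]. exists (S k). econstructor; [| exact W].
      eexists. apply flips_sym, flips_node. }
  destruct x as [t n [u |] H].
  - destruct (B t n) as [k W]. exists (S k). econstructor; [| exact W].
    eexists. apply flips_sym, flips_lift.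
  - destruct H. apply B.
Qed.

Lemma birth_ok u : lift_ok (true :: u) (lw u) (Some u).
Proof.
  simpl; split; auto. split; [auto | apply lo_hi].
Qed.

Lemma event_edge e : exists x y, flips mem x y e.
Proof.
  destruct e as [b t | n | u].
  - exists (base t 0). eexists. apply flips_node.
  - exists (base nil n). eexists. apply flips_tick.
  - exists (base (true :: u) (lw u)), (Vertex _ _ _ (birth_ok u)). apply flips_lift.
Qed.

(** * Independence between events of the same kind *)

Lemma conf_lift u v : u <> v -> conf_ev mem (Lift u) (Lift v).
Proof.
  intros N; split; [congruence|]. intros x Hu Hv. apply mem_lift in Hu, Hv. congruence.
Qed.

Lemma lift_alive x u : mem x (Lift u) = true ->
  In u (alive (pos x)) /\ lw u <= time x <= hw u.
Proof. rewrite mem_lift. destruct x as [t n l H]; simpl. intros ->; exact H. Qed.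

Lemma node_le_lift b t u : anc (b :: t) (true :: u) = true -> le_ev mem (Node b t) (Lift u).
Proof.
  intros H x Hx. apply lift_alive in Hx. destruct Hx as [Hx _].
  apply alive_anc in Hx. exact (anc_trans _ _ _ H Hx).
Qed.

Lemma node_le_node b t c s : anc (b :: t) (c :: s) = true -> le_ev mem (Node b t) (Node c s).
Proof. intros H x Hx. exact (anc_trans _ _ _ H Hx). Qed.

Lemma node_conf_node b t c s : anc (b :: t) (c :: s) = false ->
  anc (c :: s) (b :: t) = false -> conf_ev mem (Node b t) (Node c s).
Proof.
  intros H1 H2; split.
  - intros Q; injection Q as -> ->. now rewrite anc_refl in H1.
  - intros x A B. simpl in A, B.
    destruct (le_lt_dec (length t) (length s)) as [L | L].
    + rewrite (anc_chain _ _ _ A B) in H1; [discriminate | simpl; lia].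
    + rewrite (anc_chain _ _ _ B A) in H2; [discriminate | simpl; lia].
Qed.

Notation indep := (independent (le_ev mem) (conf_ev mem)).

Lemma independent_conf e f : conf_ev mem e f -> indep e f ->
  minimal_conflict (le_ev mem) (conf_ev mem) e f.
Proof. intros C [(_ & _ & N) | M]; [contradiction | auto]. Qed.

Lemma independent_not_le e f : indep e f -> ~ le_ev mem e f.
Proof.
  intros [(N & _) | [[_ C] _]] L; [contradiction|].
  destruct (event_edge f) as (x & y & F). assert (Q := proj1 F).
  destruct (mem x f) eqn:X; simpl in Q; eauto.
Qed.

Lemma independent_sym e f : indep e f -> indep f e.
Proof.
  intros [(A & B & C) | [[N C] M]].
  - left; repeat split; auto. intros [N D]. apply C. split; eauto.
  - right; split; [split; eauto|].
    intros (g & N1 & N2 & H). apply M. exists g; tauto.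
Qed.

(** Two incomparable tree edges conflict. If [t] were not an ancestor of [s], the edge entering [t]
    would already conflict with [Node c s], so the conflict would not be minimal. *)
Lemma independent_node b t c s : indep (Node b t) (Node c s) -> t = s.
Proof.
  intros H.
  assert (H1 : anc (b :: t) (c :: s) = false).
  { destruct (anc (b :: t) (c :: s)) eqn:Q; auto.
    apply node_le_node in Q. now apply independent_not_le in Q. }
  assert (H2 : anc (c :: s) (b :: t) = false).
  { destruct (anc (c :: s) (b :: t)) eqn:Q; auto.
    apply node_le_node in Q. apply independent_sym in H. now apply independent_not_le in Q. }
  destruct (independent_conf _ _ (node_conf_node _ _ _ _ H1 H2) H) as [_ M].
  assert (G : forall b t c s, anc (b :: t) (c :: s) = false ->
    anc (c :: s) (b :: t) = false ->
    (forall g, g <> Node b t -> le_ev mem g (Node b t) ->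
       g <> Node c s -> ~ conf_ev mem g (Node c s)) -> anc t s = true).
  { clear. intros b t c s H1 H2 M.
    destruct (anc t (c :: s)) eqn:Q.
    - apply anc_cons in Q. destruct Q as [-> |]; auto.
      assert (X : anc (c :: s) (b :: c :: s) = true)
        by (apply anc_cons; right; apply anc_refl). congruence.
    - destruct t as [| b' t]; [now rewrite anc_nil in Q|].
      assert (Q' : anc (c :: s) (b' :: t) = false).
      { destruct (anc (c :: s) (b' :: t)) eqn:X; auto.
        assert (Y : anc (c :: s) (b :: b' :: t) = true) by (apply anc_cons; auto).
        congruence. }
      exfalso. apply (M (Node b' t)).
      + intros X. injection X as _ X. apply (f_equal (@length bool)) in X. simpl in X; lia.
      + apply node_le_node. apply anc_cons; right; apply anc_refl.
      + intros X; injection X as -> ->. now rewrite anc_refl in Q.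
      + now apply node_conf_node. }
  apply anc_antisym.
  - apply (G b t c s); auto. intros g N1 L N2 C. apply M. exists g; tauto.
  - apply (G c s b t); auto. intros g N1 L N2 C. apply M. exists g; tauto.
Qed.

Lemma not_independent_tick m n : ~ indep (Tick m) (Tick n).
Proof.
  assert (G : forall m n, m <= n -> ~ indep (Tick m) (Tick n)).
  { intros a b L H. apply independent_not_le in H. apply H.
    intros x Hx. simpl in *. apply Nat.ltb_lt in Hx. apply Nat.ltb_lt. lia. }
  intros H. destruct (le_lt_dec m n); [apply (G m n); auto|].
  apply (G n m); [lia | now apply independent_sym].
Qed.

(** The move [Node true u] is a cause of [Lift u]. If the older set [v] is no longer there when [u]
    is born, this move already conflicts with [Lift v]. *)
Lemma independent_lift_alive u v : u <> v -> length v <= length u ->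
  minimal_conflict (le_ev mem) (conf_ev mem) (Lift u) (Lift v) -> In v (settled u).
Proof.
  intros N L [_ M]. apply NNPP; intros No. apply M. exists (Node true u).
  repeat split; try discriminate. left; split.
  - apply node_le_lift, anc_refl.
  - split; [discriminate|]. intros x Hx Hv. apply lift_alive in Hv. destruct Hv as [Hv _].
    apply No.
    assert (X : In v (alive (true :: u))).
    { apply (alive_convex v (pos x)); auto.
      apply (anc_chain _ _ (pos x)); auto using alive_anc. simpl; lia. }
    apply alive_cons in X. destruct X; auto. congruence.
Qed.

(** If [u] started after the end of [v], the tick at [hw v] would be a cause of [Lift u] in conflict
    with [Lift v]. *)
Lemma independent_lift_time u v :
  minimal_conflict (le_ev mem) (conf_ev mem) (Lift u) (Lift v) -> lw u <= hw v.
Proof.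
  intros [_ M]. apply Nat.nlt_ge; intros L. apply M. exists (Tick (hw v)).
  repeat split; try discriminate. left; split.
  - intros x Hx. apply lift_alive in Hx. simpl. apply Nat.ltb_lt. lia.
  - split; [discriminate|]. intros x Hx Hv. apply lift_alive in Hv. simpl in Hx.
    apply Nat.ltb_lt in Hx. lia.
Qed.

Lemma independent_lift u v : u <> v -> indep (Lift u) (Lift v) ->
  meets u v /\ (In v (settled u) \/ In u (settled v)).
Proof.
  intros N H.
  assert (M1 := independent_conf _ _ (conf_lift u v N) H).
  assert (M2 := independent_conf _ _ (conf_lift v u (not_eq_sym N)) (independent_sym _ _ H)).
  split; [split; now apply independent_lift_time|].
  destruct (le_lt_dec (length v) (length u));
    [left | right]; apply independent_lift_alive; auto; lia.
Qed.

(** The two older sets would both be settled when the youngest is created, hence disjoint, although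
    they meet. Cyclic patterns are excluded by word length. *)
Lemma lift_triple u v w : u <> v -> v <> w -> w <> u ->
  indep (Lift u) (Lift v) -> indep (Lift v) (Lift w) -> indep (Lift w) (Lift u) -> False.
Proof.
  intros N1 N2 N3 H1 H2 H3.
  apply (independent_lift u v N1) in H1. apply (independent_lift v w N2) in H2.
  apply (independent_lift w u N3) in H3.
  destruct H1 as [M1 [I1 | I1]], H2 as [M2 [I2 | I2]], H3 as [M3 [I3 | I3]];
    try solve [eapply settled_disjoint; eauto |
               eapply settled_disjoint; [exact I1 | exact I3 | congruence | auto] |
               eapply settled_disjoint; [exact I2 | exact I1 | congruence | auto] |
               eapply settled_disjoint; [exact I3 | exact I2 | congruence | auto]];
    apply settled_length in I1, I2, I3; lia.
Qed.

(** * The bound five, counted by kinds of events *)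

Definition is_node (e : event) : bool := match e with Node _ _ => true | _ => false end.
Definition is_tick (e : event) : bool := match e with Tick _ => true | _ => false end.
Definition is_lift (e : event) : bool := match e with Lift _ => true | _ => false end.

Lemma length_kinds l :
  length l = length (filter is_node l) + length (filter is_tick l) + length (filter is_lift l).
Proof. induction l as [| [b t | n | u] l IH]; simpl; lia. Qed.

Lemma pairwise_filter p l : pairwise_independent (le_ev mem) (conf_ev mem) l ->
  pairwise_independent (le_ev mem) (conf_ev mem) (filter p l).
Proof.
  intros [N H]; split; [now apply NoDup_filter|].
  intros e f He Hf. apply filter_In in He, Hf. apply H; tauto.
Qed.

Lemma pairwise_le_2 p l : pairwise_independent (le_ev mem) (conf_ev mem) l ->
  (forall e f g, p e = true -> p f = true -> p g = true -> e <> f -> f <> g -> g <> e ->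
     indep e f -> indep f g -> indep g e -> False) -> length (filter p l) <= 2.
Proof.
  intros H T. apply (pairwise_filter p) in H. destruct H as [N H].
  assert (P : forall e, In e (filter p l) -> p e = true)
    by (intros e He; now apply filter_In in He).
  destruct (filter p l) as [| e [| f [| g k]]]; simpl; try lia.
  exfalso. inversion N as [| ? ? A B]; subst. inversion B as [| ? ? C D]; subst.
  simpl in *. assert (e <> f /\ f <> g /\ g <> e) as (N1 & N2 & N3)
    by (repeat split; intros ->; intuition).
  apply (T e f g); auto 6.
Qed.

(** Two sibling tree edges, one tick and two lifts are the most that can occur together. *)
Lemma pairwise_le_5 l : pairwise_independent (le_ev mem) (conf_ev mem) l -> length l <= 5.
Proof.
  intros H. rewrite length_kinds.
  assert (length (filter is_node l) <= 2).
  { apply pairwise_le_2; auto.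
    intros [b t | |] [c s | |] [d r | |]; try discriminate.
    intros _ _ _ N1 N2 N3 I1 I2 _. apply independent_node in I1, I2. subst.
    destruct b, c, d; congruence. }
  assert (length (filter is_lift l) <= 2).
  { apply pairwise_le_2; auto.
    intros [| | u] [| | v] [| | w]; try discriminate.
    intros _ _ _ N1 N2 N3. apply lift_triple; congruence. }
  assert (length (filter is_tick l) <= 1).
  { destruct (pairwise_filter is_tick _ H) as [N P].
    assert (Q : forall e, In e (filter is_tick l) -> is_tick e = true)
      by (intros e He; now apply filter_In in He).
    destruct (filter is_tick l) as [| e [| f k]]; simpl; try lia.
    exfalso. inversion N as [| ? ? A B]; subst. simpl in *.
    assert (I : indep e f) by (apply P; auto; intros ->; auto).
    assert (Qe := Q e (or_introl eq_refl)). assert (Qf := Q f (or_intror (or_introl eq_refl))).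
    destruct e, f; try discriminate. now apply not_independent_tick in I. }
  lia.
Qed.

(** * Events enabled at an overlap, and the conclusion *)

Lemma flip_enabled x y e : flips mem x y e -> mem y e = true -> enabled mem x e.
Proof.
  intros F H. split; [| eauto]. apply flips_sym in F. now rewrite (proj1 F), H.
Qed.

Lemma lift_enabled u t n : In u (alive t) -> lw u <= n <= hw u ->
  enabled mem (base t n) (Lift u).
Proof.
  intros A B.
  apply (flip_enabled _ _ _ (flips_lift t n u (conj A B))). now apply mem_lift.
Qed.

Lemma node_enabled t n b : enabled mem (base t n) (Node b t).
Proof. apply (flip_enabled _ _ _ (flips_node t n b)). apply anc_refl. Qed.

Lemma tick_enabled t n : enabled mem (base t n) (Tick n).
Proof. apply (flip_enabled _ _ _ (flips_tick t n)). apply Nat.ltb_lt; simpl; lia. Qed.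

Lemma overlap_enabled u v : In v (settled u) -> meets u v ->
  exists n, enabled mem (base (true :: u) n) (Lift u) /\
            enabled mem (base (true :: u) n) (Lift v).
Proof.
  (* The later of the two starts belongs to both intervals. *)
  intros Hv [M1 M2]. exists (Nat.max (lw u) (lw v)).
  assert (Lu := lo_hi (length u)). assert (Lv := lo_hi (length v)).
  fold (lw u) (hw u) in Lu. fold (lw v) (hw v) in Lv.
  split; apply lift_enabled; simpl; auto; lia.
Qed.

Lemma overlap_distinct u v : In v (settled u) -> u <> v.
Proof. intros H ->. apply settled_length in H. lia. Qed.

Lemma five_enabled : exists x l,
  NoDup l /\ length l = 5 /\ forall e, In e l -> enabled mem x e.
Proof.
  (* The failure of the constant colouring produces an overlapping pair. *)
  destruct (colour_unbounded 1 (fun _ => 0)) as (u & v & Hv & M & _); [auto|].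
  destruct (overlap_enabled u v Hv M) as (n & Eu & Ev).
  exists (base (true :: u) n),
    (Lift u :: Lift v :: Tick n :: Node true (true :: u) :: Node false (true :: u) :: nil).
  split; [| split; [reflexivity|]].
  - repeat constructor; simpl; try (intuition discriminate).
    intros [Q | Q]; [| intuition discriminate]. injection Q as ->.
    now apply overlap_distinct in Hv.
  - intros e H. simpl in H.
    decompose [or] H; subst; auto using tick_enabled, node_enabled; contradiction.
Qed.

Notation evcls := (cls mem origin_vertex mem_ext mem_maj vertex_connected event_edge).

Lemma overlap_contact u v : In v (settled u) -> meets u v ->
  contact_adj (flip_adj mem) origin_vertex (evcls (Lift u)) (evcls (Lift v)).
Proof.
  intros Hv M. destruct (overlap_enabled u v Hv M) as (n & Eu & Ev).
  eapply enabled_contact; eauto using mem_origin, conf_lift, overlap_distinct.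
Qed.

Lemma overlap_independent u v : In v (settled u) -> meets u v ->
  independent (ev_le (flip_adj mem) origin_vertex) (ev_conf (flip_adj mem) origin_vertex)
    (evcls (Lift u)) (evcls (Lift v)).
Proof.
  intros Hv M. destruct (overlap_enabled u v Hv M) as (n & Eu & Ev).
  apply independent_cls; [apply mem_origin|].
  apply (enabled_independent mem (base (true :: u) n)); auto.
  intros Q; injection Q. now apply overlap_distinct.
Qed.

(** A position in the list, chosen by [epsilon], serves as index; it turns finitely many labels into
    finitely many natural colours. *)
Lemma finite_index {T : Type} (l : list T) :
  exists g : T -> nat, forall x y, In x l -> In y l ->
    g x < length l /\ (g x = g y -> x = y).
Proof.
  exists (fun x => epsilon (inhabits 0) (fun i => nth_error l i = Some x)).
  assert (G : forall x, In x l ->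
    nth_error l (epsilon (inhabits 0) (fun i => nth_error l i = Some x)) = Some x).
  { intros x Hx. apply (epsilon_spec (inhabits 0) (fun i => nth_error l i = Some x)).
    now apply In_nth_error. }
  intros x y Hx Hy. split.
  - apply nth_error_Some. rewrite G; [discriminate | auto].
  - intros Q. apply G in Hx, Hy. rewrite Q in Hx. congruence.
Qed.

Theorem theorem5 :
  exists (V : Type) (adj : V -> V -> Prop) (alpha : V),
    simple_graph adj /\ connected adj /\ infinite_type V /\ median adj /\
    max_outdeg_eq adj alpha 5 /\
    infinite_chromatic (contact_adj adj alpha) /\
    degree_eq (ev_le adj alpha) (ev_conf adj alpha) 5 /\
    (forall (L : Type) (lab : theta_class adj -> L),
       nice_labeling (ev_le adj alpha) (ev_conf adj alpha) lab ->
       infinite_type (sig (fun l : L => exists C, lab C = l))).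
Proof.
  exists vertex, (flip_adj mem), origin_vertex.
  destruct five_enabled as (x & l & Hl).
  destruct (degree_outdeg mem origin_vertex mem_ext mem_maj mem_origin vertex_connected
              event_edge 5 x pairwise_le_5 (ex_intro _ l Hl)) as [Out Deg].
  split; [apply flip_simple|].
  split; [exact (flip_connected mem origin_vertex vertex_connected)|].
  split.
  { intros [vs H].
    (* The vertices above the root of the tree form an infinite ray. *)
    assert (N : NoDup (map (base nil) (seq 0 (S (length vs))))).
    { apply Injective_map_NoDup; [| apply seq_NoDup].
      intros a b Q. now apply (f_equal time) in Q. }
    apply (NoDup_incl_length (l' := vs)) in N; [| intros y _; apply H].
    rewrite length_map, length_seq in N. lia. }
  split; [exact (flip_median mem origin_vertex mem_ext mem_maj vertex_connected)|].
  split; [exact Out|]. split; [| split; [exact Deg|]].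
  - intros n (f & B & P).
    destruct (colour_unbounded n (fun u => f (evcls (Lift u)))) as (u & v & Hv & M & Q);
      [auto|].
    exact (P _ _ (overlap_contact u v Hv M) Q).
  - intros L lab Nice [ls Hls].
    (* Labels are taken in the subtype of those in use, which is what [ls] is assumed to list; their
       indices then colour the sets. *)
    set (used := fun u => exist (fun l : L => exists C, lab C = l)
                           (lab (evcls (Lift u))) (ex_intro _ _ eq_refl)).
    destruct (finite_index ls) as [g Hg].
    destruct (colour_unbounded (length ls) (fun u => g (used u))) as (u & v & Hv & M & Q).
    { intros u. now apply (Hg (used u) (used u)). }
    apply (Hg (used u) (used v) (Hls _) (Hls _)) in Q.
    apply (f_equal (@proj1_sig _ _)) in Q.
    exact (Nice _ _ (overlap_independent u v Hv M) Q).
Qed.
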